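(* Let $\rho:\mathscr B(\mathcal F)\to[0,\infty]$ be the measure constructed in the context. Then every open subset $U$ of $\mathcal F$ is inner regular, i.e. $\rho(U)=\sup\{\rho(K): K\subset U \text{ compact}\}$. Moreover, the measure $\rho$ is regular.
   Context: A measure on $\mathscr B(\mathcal F)$ is regular if every Borel set $A$ is inner regular ($\rho(A)=\sup\{\rho(K):K\subset A\text{ compact}\}$) and outer regular ($\rho(A)=\inf\{\rho(U):U\supset A\text{ open}\}$). Setting. $X$ is an infinite-dimensional separable complex Banach space, $\mathcal F\subset X$ is a non-locally compact Polish subspace, and $d$ is the metric on $\mathcal F$ induced by the norm of $X$; $(\mathcal F,d)$ is a separable complete metric space. $\mathscr B(\mathcal F)$ is the Borel $\sigma$-algebra. The Lagrangian $\mathcal L:\mathcal F\times\mathcal F\to[0,\infty)$ is continuous, symmetric, satisfies $\mathcal L(x,x)>0$ for all $x\in\mathcal F$, and is of bounded range: every bounded set $B\subset\mathcal F$ is contained in a bounded neighborhood $B'\subset\mathcal F$ with $\mathcal L(x,y)=0$ for all $x\in B$, $y\notin B'$. Construction of $\rho$. (1) Fix finite-dimensional subspaces $X_1\subset X_2\subset\cdots$ of $X$ with $\bigcup_n X_n$ dense in $X$ and put $\mathcal F^{(n)}:=\mathcal F\cap X_n$; these are second-countable, locally compact Hausdorff spaces. (2) For each $n$ fix a regular Borel (i.e. locally finite) measure $\rho_n$ on $\mathcal F^{(n)}$ (provided by the known existence theory in the locally compact case) which is a minimizer under variations of compact support of the action $\int\!\int_{\mathcal F^{(n)}\times\mathcal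 F^{(n)}}\mathcal L\,d\rho\,d\rho$ (at fixed total volume) and satisfies $\ell_n|_{\operatorname{supp}\rho_n}\equiv\inf_{\mathcal F^{(n)}}\ell_n=0$, where $\ell_n(x)=\int_{\mathcal F^{(n)}}\mathcal L(x,y)\,d\rho_n(y)-1$. Extend by zero: $\rho^{[n]}(A):=\rho_n(A\cap\mathcal F^{(n)})$ for $A\in\mathscr B(\mathcal F)$. (3) Fix a countable dense $E\subset\mathcal F$ such that $E^{(n)}:=E\cap\mathcal F^{(n)}=\{x^{(n)}_j\}_{j}$ is dense in $\mathcal F^{(n)}$ for all $n$, and for all $j,k,n\in\mathbb N$ a compact neighborhood $V^{(n)}_{j,k}\subset\mathcal F^{(n)}$ of $x^{(n)}_j$ (in $\mathcal F^{(n)}$) with $V^{(n)}_{j,k}\subset B_{1/k}(x^{(n)}_j)$ which is the closure of its interior in $\mathcal F^{(n)}$. $\mathscr D$ is the countable family consisting of $\varnothing$ and all finite unions of sets $V^{(n)}_{j,k}$. (4) By Prohorov's theorem and a diagonal argument, fix a subsequence $\rho^{(k)}=\rho^{[n_k]}$ of $(\rho^{[n]})$ such that for every $D\in\mathscr D$ the restrictions $\rho^{(k)}|_D$ converge weakly to a finite measure on $\mathscr B(D)$. Put $\varphi(D):=\lim_k\rho^{(k)}(D)$ for $D\in\mathscr D$, $\mu(U):=\sup\{\varphi(D):D\subset U,\ D\in\mathscr D\}$ for $U\subset\mathcal F$ open, $\eta(A):=\inf\{\mu(U):A\subset U,\ U\text{ open}\}$ for $A\subset\mathcal F$, and $\rho:=\eta|_{\mathscr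 B(\mathcal F)}$, which is a measure satisfying $\rho(D)=\varphi(D)$ for $D\in\mathscr D$. *)

(* Defs.v *)
From HB Require Import structures.
From mathcomp Require Import all_boot all_order all_algebra.
From mathcomp Require Import complex.
From mathcomp Require Import all_classical all_reals all_analysis.

Set Implicit Arguments.
Unset Strict Implicit.
Unset Printing Implicit Defensive.

Import Order.TTheory GRing.Theory Num.Theory.
Import numFieldTopology.Exports numFieldNormedType.Exports.

Local Open Scope classical_set_scope.
Local Open Scope ring_scope.

Definition span (K : numFieldType) (X : lmodType K) (s : seq X) : set X :=
  [set x | exists c : 'I_(size s) -> K, x = \sum_(i < size s) c i *: s`_i].

Definition finite_dim_subspace (K : numFieldType) (X : lmodType K)
    (V : set X) : Prop :=
  exists s : seq X, V = span s.

Definition separable (T : topologicalType) : Prop :=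
  exists E : set T, countable E /\ dense E.

Definition complete_space (T : uniformType) : Prop :=
  forall G : set_system T, ProperFilter G -> cauchy G -> exists x : T, G --> x.

(** Measurable types are pointed in the library whereas subspaces are not, so
    the Borel space of [T] takes a point of [T] as an argument. The sigma-algebra
    does not depend on it. *)
Definition pointed_at (T : Type) (p : T) : Type := T.

HB.instance Definition _ (T : choiceType) (p : T) :=
  Choice.copy (pointed_at p) T.
HB.instance Definition _ (T : topologicalType) (p : T) :=
  Topological.copy (pointed_at p) T.
HB.instance Definition _ (T : choiceType) (p : T) :=
  isPointed.Build (pointed_at p) p.

Notation borel p := (g_sigma_algebraType (@open (pointed_at p))).

Section BorelMeasure.
Local Open Scope ereal_scope.
Context (R : realType) (T : topologicalType) (p : T).
Implicit Types (m : {measure set (borel p) -> \bar R}) (A K U D : set T).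

Definition inner_regular m A : Prop :=
  m A = ereal_sup [set m K | K in [set K | compact K /\ K `<=` A]].

Definition outer_regular m A : Prop :=
  m A = ereal_inf [set m U | U in [set U | open U /\ A `<=` U]].

Definition regular_measure m : Prop :=
  forall A : set (borel p), measurable A -> inner_regular m A /\ outer_regular m A.

Definition locally_finite m : Prop :=
  forall x : T, exists U, open_nbhs x U /\ m U < +oo.

Definition measure_support m : set T :=
  [set x | forall U, open_nbhs x U -> 0 < m U].

(** Weak convergence of the restrictions of [m_ k] to [D]; a measure on the Borel
    sets of [D] is represented by a Borel measure on [T] vanishing off [D]. *)
Definition weak_cvg_on D (m_ : nat -> {measure set (borel p) -> \bar R})
    (nu : {finite_measure set (borel p) -> \bar R}) : Prop :=
  nu (~` D) = 0 /\
  forall f : T -> R, {within D, continuous f} -> [bounded f x | x in D] ->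
    (fun k => \int[m_ k]_(x in D) (f x)%:E) @ \oo -->
      \int[nu]_(x in D) (f x)%:E.

(** The integral of [f] with respect to the signed measure [m' - m] when the
    latter is supported on a compact set [K]; both measures may be infinite
    on [T]. *)
Definition diff_integral (m' m : {measure set (borel p) -> \bar R}) K
    (f : T -> \bar R) : \bar R :=
  \int[m']_(x in K) f x - \int[m]_(x in K) f x.

(** The actions of [m'] and [m] may both be infinite: their difference is defined
    by expanding it in powers of [m' - m]. *)
Definition action_diff (L : T -> T -> R) (m' m : {measure set (borel p) -> \bar R})
    K : \bar R :=
  diff_integral m' m K (fun x => \int[m]_y (L x y)%:E)
  + \int[m]_x diff_integral m' m K (fun y => (L x y)%:E)
  + diff_integral m' m K (fun x => diff_integral m' m K (fun y => (L x y)%:E)).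

Definition minimizer_compact_variations (L : T -> T -> R) m : Prop :=
  forall (m' : {measure set (borel p) -> \bar R}) K,
    regular_measure m' -> locally_finite m' -> compact K ->
    (forall A : set (borel p), measurable A -> A `<=` ~` K -> m' A = m A) ->
    m' K = m K ->
    0 <= action_diff L m' m K.

Definition ell (L : T -> T -> R) m (x : T) : \bar R :=
  \int[m]_y (L x y)%:E - 1.

End BorelMeasure.

Section ExtendByZero.
Local Open Scope ereal_scope.
Context (R : realType) (T : topologicalType) (A : set T) (q : A) (p : T).
Variable m : {measure set (borel q) -> \bar R}.

(** [set_val @^-1` B] is [B `&` A], viewed as a subset of [A]. *)
Definition extend_by_zero : set (borel p) -> \bar R :=
  fun B => m (set_val @^-1` B).

Lemma measurable_set_val :
  measurable_fun [set: borel q] (set_val : borel q -> borel p).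
Proof.
apply: (@measurability _ _ (borel q) (borel p) _ _ (@open T)) => //.
move=> _ [U oU <-]; apply: sub_sigma_algebra.
by rewrite setTI; exists U.
Qed.

Let measurable_preimage (B : set (borel p)) :
  measurable B -> measurable (set_val @^-1` B : set (borel q)).
Proof. by move=> mB; rewrite -[X in measurable X]setTI; exact: measurable_set_val. Qed.

Let extend_by_zero0 : extend_by_zero set0 = 0.
Proof. by rewrite /extend_by_zero preimage_set0 measure0. Qed.

Let extend_by_zero_ge0 B : 0 <= extend_by_zero B.
Proof. exact: measure_ge0. Qed.

Let extend_by_zero_sigma_additive : semi_sigma_additive extend_by_zero.
Proof.
move=> F mF tF mUF; rewrite /extend_by_zero preimage_bigcup.
apply: measure_semi_sigma_additive.
- by move=> n; exact: measurable_preimage.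
- apply/trivIsetP => /= i j _ _ ij; rewrite -preimage_setI.
  by move/trivIsetP : tF => /(_ _ _ _ _ ij) ->//; rewrite preimage_set0.
- by rewrite -preimage_bigcup; exact: measurable_preimage.
Qed.

HB.instance Definition _ := isMeasure.Build _ _ _ extend_by_zero
  extend_by_zero0 extend_by_zero_ge0 extend_by_zero_sigma_additive.

End ExtendByZero.
Arguments extend_by_zero {R T A q} p m _.

(** The intersection of [F] with [V], as a subset (hence a subspace) of [F]. *)
Definition slice (X : Type) (F V : set X) : set F := set_val @^-1` V.
Arguments slice {X} F V _.

Section Construction.
Local Open Scope ereal_scope.
Context (R : realType) (X : completeNormedModType R[i]) (F : set X).

Definition bounded_subset (B : set F) : Prop := bounded_set (set_val @` B).

Definition bounded_range (L : F -> F -> R) : Prop :=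
  forall B : set F, bounded_subset B ->
    exists B' : set F, [/\ B `<=` B'°, bounded_subset B' &
      forall x y, B x -> ~ B' y -> L x y = 0%R].

Definition slice_lagrangian (L : F -> F -> R) (V : set X) :
    slice F V -> slice F V -> R :=
  fun x y => L (set_val x) (set_val y).

Definition finite_unions (X_ : nat -> set X)
    (V : forall n, nat -> nat -> set (slice F (X_ n))) : set (set F) :=
  [set D | exists s : seq (nat * nat * nat),
     D = \big[setU/set0]_(t <- s) (set_val @` V t.1.1 t.1.2 t.2)].

Definition limit_content (r : nat -> set F -> \bar R) (D : set F) : \bar R :=
  limn (fun k => r k D).

(** Only meant for open [U]. *)
Definition inner_content (DD : set (set F)) (phi : set F -> \bar R)
    (U : set F) : \bar R :=
  ereal_sup [set phi D | D in [set D | DD D /\ D `<=` U]].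

Definition outer_content (mu : set F -> \bar R) (A : set F) : \bar R :=
  ereal_inf [set mu U | U in [set U | open U /\ A `<=` U]].

End Construction.
Arguments slice_lagrangian {R X F} L V _ _.

(* Main.v *)
Require Import Defs.
From HB Require Import structures.
From mathcomp Require Import all_boot all_order all_algebra.
From mathcomp Require Import complex lra.
From mathcomp Require Import all_classical all_reals all_analysis.
From mathcomp Require Import measurable_realfun.

(* Each [D] in the family is compact with [phi D <= rho D], hence [rho] is inner
   regular on open sets, and it is outer regular by construction. It is locally
   finite: around [x] there is an open [U] with [L >= c > 0] on [U] times [U]; if
   [z] is a point of [U] in the support of [rho_n], the integral of [L z] with
   respect to [rho_n] is 1, hence [rho_n U <= 1/c] for all [n], which passes to the
   limit. As [F] is Lindelof, it is covered by countably many open sets of finite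
   measure, and on each of them inner regularity passes from open sets to Borel
   sets by outer regularity. *)

Set Implicit Arguments.
Unset Strict Implicit.
Unset Printing Implicit Defensive.

Import Order.TTheory GRing.Theory Num.Theory.
Import numFieldTopology.Exports numFieldNormedType.Exports.

Local Open Scope classical_set_scope.
Local Open Scope ring_scope.

(** * Inner regularity: from open sets to Borel sets *)

Section BorelRegularity.
Local Open Scope ereal_scope.
Context (R : realType) (T : topologicalType) (p : T).
Variable m : {measure set (borel p) -> \bar R}.
Implicit Types A K U W : set T.

Lemma open_borel U : open U -> measurable (U : set (borel p)).
Proof. by move=> oU; exact: sub_sigma_algebra. Qed.

Lemma compact_borel K : hausdorff_space T -> compact K ->
  measurable (K : set (borel p)).
Proof.
move=> hT cK; rewrite -(setCK K); apply: measurableC; apply: open_borel.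
by apply: closed_openC; exact: compact_closed.
Qed.

(* If [W] is an open set of almost minimal measure containing [U `\` A] and [K] a
   compact subset of [U] of almost full measure, then [K `\` W] is compact,
   contained in [A] and exhausts [A `&` U] up to [e]. *)
Lemma compact_exhaustion_in_open A U (e : R) : hausdorff_space T ->
    (forall A', measurable (A' : set (borel p)) -> outer_regular m A') ->
    inner_regular m U -> measurable (A : set (borel p)) -> open U ->
    m U < +oo -> (0 < e)%R ->
  exists K, [/\ compact K, K `<=` A & m (A `&` U) <= m K + e%:E].
Proof.
move=> hT outer innerU mA oU Uoo e0.
have mU := open_borel oU.
have mUA : measurable (U `\` A : set (borel p)) by exact: measurableD.
have mAU : measurable (A `&` U : set (borel p)) by exact: measurableI.
have fin A' : measurable (A' : set (borel p)) -> A' `<=` U -> m A' \is a fin_num.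
  move=> mA' A'U; rewrite ge0_fin_numE//; apply: le_lt_trans Uoo.
  by rewrite le_measure ?inE.
have e20 : (0 < e / 2)%R by rewrite divr_gt0.
have [_ [K [cK KU] <-] UK] : exists2 y,
    [set m K | K in [set K | compact K /\ K `<=` U]] y & m U - (e / 2)%:E < y.
  have E : m U = ereal_sup _ := innerU.
  rewrite E; apply: ub_ereal_sup_adherent => //; rewrite -E.
  exact: fin _ mU (@subset_refl _ U).
have [_ [W [oW UAW] <-] WUA] : exists2 y,
    [set m W | W in [set W | open W /\ U `\` A `<=` W]] y &
    y < m (U `\` A) + (e / 2)%:E.
  have E : m (U `\` A) = ereal_inf _ := outer _ mUA.
  rewrite E; apply: lb_ereal_inf_adherent => //; rewrite -E.
  exact: fin _ mUA (@subDsetl _ U A).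
have mK := compact_borel hT cK; have mW := open_borel oW.
exists (K `\` W); split.
- by rewrite setDE; apply: compact_closedI => //; exact: open_closedC.
- move=> x [Kx Wx]; apply: contrapT => Ax; apply: Wx; apply: UAW; split => //.
  exact: KU.
- have K_le : m K <= m (K `\` W) + m W.
    rewrite [leLHS](measureDI m mK mW); apply: leeD => //.
    by rewrite le_measure ?inE//; exact: measurableI.
  have U_eq : m U = m (U `\` A) + m (A `&` U).
    by rewrite [LHS](measureDI m mU mA) [in X in _ = _ + X]setIC.
  have mKW : measurable (K `\` W : set (borel p)) by exact: measurableD.
  have := fin _ mUA (@subDsetl _ U A); have := fin _ mAU (@subIsetr _ A U).
  have := fin (K `\` W) mKW (subset_trans (@subDsetl _ K W) KU).
  have := fin _ mK KU.
  (* [m W] is finite by [WUA]. In the variables introduced below, the claim is [au < k + e/2 - ua <=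
     kw + w + e/2 - ua < kw + e]. *)
  move: UK K_le WUA; rewrite U_eq.
  move: (m K) (m W) (m (K `\` W)) (m (U `\` A)) (m (A `&` U)).
  move=> [k||] [w||] [kw||] [ua||] [au||]//=.
  by rewrite -!EFinD !lte_fin !lee_fin => ? ? ? _ _ _ _; lra.
Qed.

(** The finite unions [W n] of the cover are open, have finite measure and increase to the whole
    space. Hence [m A] is the limit of the measures of the traces of [A] on [W n], and each trace
    can be exhausted by compact subsets of [A]. *)
Lemma regular_measure_open_cover (U_ : nat -> set T) : hausdorff_space T ->
    (forall A, measurable (A : set (borel p)) -> outer_regular m A) ->
    (forall U, open U -> inner_regular m U) ->
    (forall n, open (U_ n)) -> (forall n, m (U_ n) < +oo) ->
    \bigcup_n U_ n = setT ->
  regular_measure m.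
Proof.
move=> hT outer inner oU Uoo Ucov A mA; split; last exact: outer.
pose W n := \big[setU/set0]_(i < n) U_ i.
have oW n : open (W n) by rewrite /W -bigcup_mkord; apply: bigcup_open.
have mW n := open_borel (oW n).
have Woo n : m (W n) < +oo.
  rewrite /W; elim: n => [|n IHn]; first by rewrite big_ord0 measure0.
  rewrite big_ord_recr/=; apply: le_lt_trans (lte_add_pinfty IHn (Uoo n)).
  by apply: measureU2; [exact: mW n|exact: open_borel].
have Wcov : \bigcup_n W n = setT.
  rewrite -subTset -Ucov => x [n _ Unx]; exists n.+1 => //.
  by rewrite /W big_ord_recr; right.
apply/eqP; rewrite eq_le; apply/andP; split; last first.
  apply: ge_ereal_sup => _ [K /= [cK KA] <-].
  by rewrite le_measure ?inE//; exact: compact_borel.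
have mAW n : measurable (A `&` W n : set (borel p)) by exact: measurableI.
have -> : m A = m (\bigcup_n (A `&` W n)) by rewrite -setI_bigcupr Wcov setIT.
have cvgW : m (A `&` W n) @[n --> \oo] --> m (\bigcup_n (A `&` W n)).
  apply: nondecreasing_cvg_mu => //; first exact: bigcup_measurable.
  move=> i j ij; apply/subsetPset; apply: setIS.
  rewrite /W -!bigcup_mkord => x [k /= ki Ukx].
  by exists k => //=; exact: leq_trans ij.
(* Bounding each term by the supremum, up to any [e], bounds the limit, even when [m A] is
   infinite. *)
apply: (cvge_to_le cvgW); apply: nearW => n; apply/lee_addgt0Pr => e e0.
have [K [cK KA le]] :=
  compact_exhaustion_in_open hT outer (inner _ (oW n)) mA (oW n) (Woo n) e0.
apply: (le_trans le); rewrite leeD2r//; apply: ereal_sup_ubound.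
by exists K.
Qed.

End BorelRegularity.

(** * Countable subcovers *)

(** Radii of balls live in [R[i]], but a positive element of [R[i]] is a positive real, so the radii
    [1/(n+1)] give a countable base of entourages. *)
Lemma countable_uniformity_subspace (R : realType)
    (X : completeNormedModType R[i]) (F : set X) :
  countable_uniformity F.
Proof.
apply/countable_uniformityP.
exists (fun n => [set xy : F * F |
  ball (set_val xy.1 : X) (n.+1%:R^-1 : R[i]) (set_val xy.2)]).
  move=> A [B]; rewrite -entourage_ballE => -[e /= e0 eB] BA.
  have [eR Re0] : e = (complex.Re e)%:C%C /\ 0 < complex.Re e.
    move: e0; rewrite ltcE/= => /andP[/eqP].
    by case: {eB} e => a b /= -> ->.
  (* For this index [n], [n.+1] exceeds the inverse of the real part of [e]. *)
  exists (Num.truncn (complex.Re e)^-1) => xy /= xyB; apply: BA; apply: eB => /=.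
  apply: le_ball xyB; rewrite eR -(rmorph_nat (@real_complex R)) -fmorphV lecR.
  by rewrite -[leRHS]invrK lef_pV2 ?posrE ?invr_gt0// ltW// truncnS_gt.
move=> n; exists [set xy : X * X | ball xy.1 (n.+1%:R^-1 : R[i]) xy.2] => //.
by apply: (entourage_ball X (n.+1%:R^-1%:pos : {posnum R[i]})).
Qed.

(** For each basic entourage [f i] and dense point [s j], choose one open set in [P] containing the
    section of [f i] at [s j], if there is any. Every [x] lies in such a section that is small
    enough to fit into a neighborhood of [x] in [P]. *)
Lemma separable_lindelof (T : uniformType) (P : set (set T)) :
    T -> countable_uniformity T -> separable T ->
    (forall x, exists2 U, open_nbhs x U & P U) ->
  exists U_ : nat -> set T,
    [/\ forall n, open (U_ n), forall n, P (U_ n) & \bigcup_n U_ n = setT].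
Proof.
move=> t /countable_uniformityP[f fA entf] [S [cS dS]] nbhsP.
have [t' [_ St']] : setT `&` S !=set0 by apply: dS; [exists t|exact: openT].
move/pfcard_geP : cS => [S0|/unsquash s]; first by rewrite S0 in St'.
have /choice[W WP] (ij : nat * nat) : exists W, [/\ open W, P W &
    (exists U, [/\ open U, P U & xsection (f ij.1) (s ij.2) `<=` U]) ->
    xsection (f ij.1) (s ij.2) `<=` W].
  have [[U [oU PU fU]]|noU] :=
    pselect (exists U, [/\ open U, P U & xsection (f ij.1) (s ij.2) `<=` U]).
    by exists U.
  (* If no open set in [P] contains the section, a neighborhood of [t] serves as a default. *)
  by have [U [oU _] PU] := nbhsP t; exists U; split.
(* Numbers coding no pair are sent to [(0, 0)], which only repeats a set. *)
exists (fun n => W (odflt (0, 0)%N (unpickle n))); split.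
- by move=> n; have [] := WP (odflt (0, 0)%N (unpickle n)).
- by move=> n; have [] := WP (odflt (0, 0)%N (unpickle n)).
rewrite -subTset => x _; have [U [oU Ux] PU] := nbhsP x.
have : nbhs x U by exact: open_nbhs_nbhs.
rewrite -nbhs_entourageE => -[A entA AU].
have [i fi] := fA _ (entourage_split_ent entA).
(* A dense point [y] near [x] must satisfy two conditions: [(y, x)] in [f i] puts [x] in the section
   at [y], and [(x, y)] in [split_ent A] keeps that section inside [U]. *)
have entB : entourage (split_ent A `&` (f i)^-1)%relation.
  by apply: filterI; [exact: entourage_split_ent|exact: entourage_inv].
have [oB Bx] := open_nbhs_entourage x entB.
have [y [By Sy]] := dS _ (ex_intro _ x Bx) oB.
have [j _ sj] : (s @` setT) y by exact: (@surj _ _ _ _ s).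
have := interior_subset By; rewrite /xsection/= inE => -[xy yx].
exists (pickle (i, j)) => //; rewrite pickleK/=.
have [_ _ ] := WP (i, j); apply; last by rewrite /xsection/= inE sj.
exists U; split => // z; rewrite /xsection/= inE sj => yz.
apply: AU; rewrite /xsection/= inE; apply: entourage_split entA xy _.
exact: fi.
Qed.

(** * Mass bound for measures with [ell] vanishing on the support *)

Section MassBound.
Local Open Scope ereal_scope.
Context (R : realType) (T : topologicalType) (q : T).
Variable m : {measure set (borel q) -> \bar R}.
Implicit Types U K : set T.

Lemma continuous_borel_measurable (f : T -> R) : continuous f ->
  measurable_fun [set: borel q] (f : borel q -> R).
Proof.
move=> cf; apply: (measurability _ (RGenOInfty.measurableE R)) => //.
move=> _ [_ [a ->] <-]; rewrite setTI; apply: open_borel.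
by apply: open_comp; [move=> x _; exact: cf|exact: interval_open].
Qed.

(** A compact subset of [U] is covered by open null sets, hence by finitely many of them. Inner
    regularity passes this to [U] without any countability assumption on [T]. *)
Lemma measure_off_support U : hausdorff_space T -> inner_regular m U ->
  U `&` measure_support m = set0 -> m U = 0.
Proof.
move=> hT innerU Usupp; have E : m U = ereal_sup _ := innerU.
apply/eqP; rewrite eq_le measure_ge0 andbT E.
apply: ge_ereal_sup => _ [K /= [cK KU] <-].
pose pT : ptopologicalType := HB.pack T (isPointed.Build T q).
have : @cover_compact pT K by rewrite -compact_cover.
move=> /(_ _ [set W | open W /\ m W = 0] id)[|x Kx|].
- by move=> W [].
- apply: contrapT => Nx; have : (U `&` measure_support m) x.
    split; first exact: KU.
    move=> W [oW Wx]; rewrite lt0e measure_ge0 andbT.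
    by apply/eqP => W0; apply: Nx; exists W.
  by rewrite Usupp.
move=> D' D'0; rewrite /cover bigcup_fset => KD'.
have [mD mD0] : measurable (\big[setU/set0]_(W <- finmap.enum_fset D') W
      : set (borel q)) /\ m (\big[setU/set0]_(W <- finmap.enum_fset D') W) = 0.
  rewrite big_seq; elim/big_rec: _ => [|W B /D'0/set_mem[oW W0] [mB B0]].
    by split; [exact: measurable0|exact: measure0].
  have mW : measurable (W : set (borel q)) := open_borel oW; split; first exact: measurableU.
  exact: null_set_setU.
by rewrite -mD0 le_measure ?inE//; exact: compact_borel.
Qed.

(* [ell] vanishes at a point [z] of the support in [U], so the integral of
   [L z] is 1 and Markov's inequality applies. *)
Lemma minimizer_mass_bound (L : T -> T -> R) U (c : R) : hausdorff_space T ->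
    (forall x y, (0 <= L x y)%R) -> (forall x, continuous (L x)) ->
    (forall x, measure_support m x -> ell L m x = 0) ->
    inner_regular m U -> open U -> (0 < c)%R ->
    (forall x y, U x -> U y -> (c <= L x y)%R) ->
  m U <= (c^-1)%:E.
Proof.
move=> hT L0 cL ell0 innerU oU c0 cU.
have [Usupp|/set0P[z [Uz /ell0 ellz]]] := eqVneq (U `&` measure_support m) set0.
  by rewrite measure_off_support// lee_fin invr_ge0 ltW.
have mL : measurable_fun [set: borel q] (EFin \o (L z : borel q -> R)).
  by apply/measurable_EFinP; exact: continuous_borel_measurable.
have mU : measurable (U : set (borel q)) := open_borel oU.
have Lz1 : \int[m]_y (L z y)%:E = 1.
  move: ellz; rewrite /ell; case: (integral _ _ _) => [r||]//.
  by rewrite -EFinB => -[/subr0_eq ->].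
have : \int[m]_(x in U) cst c%:E x <= 1.
  rewrite -Lz1; apply: (@le_trans _ _ (\int[m]_(y in U) (L z y)%:E)).
    apply: ge0_le_integral => //.
    - by move=> y _; rewrite lee_fin ltW.
    - exact: measurable_funTS.
    - by move=> y Uy; rewrite lee_fin cU.
  by apply: ge0_subset_integral => // y _; rewrite lee_fin.
rewrite integral_cst// muleC -lee_pdivlMr//.
by rewrite mul1e.
Qed.

End MassBound.

(** * Contents and the limit measure *)

Lemma hausdorff_subspace (T : topologicalType) (A : set T) :
  hausdorff_space T -> hausdorff_space A.
Proof.
move=> hT x y xy; apply: val_inj; apply: hT => U V xU yV.
have [z [Uz Vz]] := xy _ _ (@initial_continuous _ _ set_val x _ xU)
  (@initial_continuous _ _ set_val y _ yV).
by exists (set_val z).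
Qed.

Section Contents.
Local Open Scope ereal_scope.
Context (R : realType) (X : completeNormedModType R[i]) (F : set X).
Implicit Types (DD : set (set F)) (phi mu : set F -> \bar R) (A D U W : set F).

Lemma inner_content_homo DD phi :
  {homo inner_content DD phi : U W / U `<=` W >-> U <= W}.
Proof.
move=> U W UW; apply: ereal_sup_le => _ [D [DDD DU] <-].
by exists D => //; split => //; exact: subset_trans UW.
Qed.

(** By monotonicity of the inner content, the infimum is attained at [U] itself. *)
Lemma outer_content_open DD phi U : open U ->
  outer_content (inner_content DD phi) U = inner_content DD phi U.
Proof.
move=> oU; apply/eqP; rewrite eq_le; apply/andP; split.
  by apply: ereal_inf_lbound; exists U => //; split.
apply: le_ereal_inf_tmp => _ [W [oW UW] <-].
exact: inner_content_homo.
Qed.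

Lemma finite_unions_compact (X_ : nat -> set X)
    (V : forall n, nat -> nat -> set (slice F (X_ n))) D :
  (forall n j k, compact (V n j k)) -> finite_unions V D -> compact D.
Proof.
move=> cV [s ->]; apply: bigsetU_compact => t _; apply: continuous_compact => //.
by apply: continuous_subspaceT; exact: initial_continuous.
Qed.

(* [f = 1] is a test function for the weak convergence. *)
Lemma weak_cvg_on_mass (p : F) D (m_ : nat -> {measure set (borel p) -> \bar R})
    (nu : {finite_measure set (borel p) -> \bar R}) :
  measurable (D : set (borel p)) -> weak_cvg_on D m_ nu ->
  m_ k D @[k --> \oo] --> nu D.
Proof.
move=> mD [_ cvg_int].
have massE (m : {measure set (borel p) -> \bar R}) :
    m D = \int[m]_(x in D) (cst 1%R x)%:E.
  by rewrite -[LHS]mul1e -(integral_cst m mD).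
rewrite massE (funext (fun k => massE (m_ k))); apply: cvg_int.
  by apply: continuous_subspaceT => x; exact: cst_continuous.
by exists 1%R; split => // r r1 x _ /=; rewrite normr1 ltW.
Qed.

Context (X_ : nat -> set X) (V : forall n, nat -> nat -> set (slice F (X_ n))).
Arguments V : clear implicits.
Context (p : F) (m_ : nat -> {measure set (borel p) -> \bar R}).
Context (rho : {measure set (borel p) -> \bar R}).
Context (V_compact : forall n j k, compact (V n j k)).
Context (rhoE : forall A : set (borel p), measurable A ->
  rho A = outer_content (inner_content (finite_unions V)
    (limit_content (fun k => m_ k))) A).

Lemma limit_measure_open U : open U ->
  rho U = inner_content (finite_unions V) (limit_content (fun k => m_ k)) U.
Proof. by move=> oU; rewrite rhoE; [exact: outer_content_open|exact: open_borel]. Qed.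

Lemma limit_measure_outer_regular A :
  measurable (A : set (borel p)) -> outer_regular rho A.
Proof.
move=> mA; rewrite /outer_regular [LHS]rhoE//; congr ereal_inf.
by apply/seteqP; split => _ [U [oU AU] <-]; exists U => //;
  rewrite limit_measure_open.
Qed.

Lemma limit_measure_open_inner_regular U : open U -> inner_regular rho U.
Proof.
move=> oU; have hF : hausdorff_space F.
  by apply: hausdorff_subspace; exact: norm_hausdorff.
apply/eqP; rewrite eq_le; apply/andP; split; last first.
  apply: ge_ereal_sup => _ [K /= [cK KU] <-].
  by rewrite le_measure ?inE//; [exact: compact_borel|exact: open_borel].
rewrite [leLHS]limit_measure_open//; apply: ge_ereal_sup => _ [D [DD DU] <-].
have cD := finite_unions_compact V_compact DD.
(* The limit content of [D] is at most [rho D], since [D] competes in the supremum defining the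
   inner content of every open [W] containing [D]. *)
apply: (@le_trans _ _ (rho D)); last by apply: ereal_sup_ubound; exists D.
rewrite rhoE; last exact: compact_borel.
apply: le_ereal_inf_tmp => _ [W [oW DW] <-].
by apply: ereal_sup_ubound; exists D.
Qed.

End Contents.

(** * Local finiteness of the limit measure and conclusion *)

Lemma lagrangian_pos_nbhs (R : realType) (T : topologicalType) (L : T -> T -> R)
    (x : T) :
  continuous (fun z : T * T => L z.1 z.2) -> 0 < L x x ->
  exists2 U, open_nbhs x U & forall y z, U y -> U z -> L x x / 2 <= L y z.
Proof.
move=> cL Lx.
have : \forall z \near (x, x), L x x / 2 <= L z.1 z.2.
  have := cL (x, x); rewrite /continuous_at/= => /cvgr_ge; apply.
  by rewrite ltr_pdivrMr// ltr_pMr// ltr1n.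
case=> -[A B] /= [xA xB] AB.
have : nbhs x (A `&` B) by exact: filterI.
rewrite nbhsE => -[U oU UAB]; exists U => // y z Uy Uz.
by apply: (AB (y, z)); split; [have [] := UAB _ Uy|have [] := UAB _ Uz].
Qed.

Theorem lemma4p4 (R : realType) (X : completeNormedModType R[i])
  (X_separable : separable X)
  (X_infinite_dim : ~ finite_dim_subspace [set: X])
  (F : set X)
  (F_separable : separable F)
  (F_complete : complete_space F)
  (F_not_locally_compact : ~ locally_compact [set: F])
  (* the Lagrangian *)
  (L : F -> F -> R)
  (L_ge0 : forall x y, 0 <= L x y)
  (L_continuous : continuous (fun z : F * F => L z.1 z.2))
  (L_sym : forall x y, L x y = L y x)
  (L_diag_gt0 : forall x, 0 < L x x)
  (L_bounded_range : bounded_range L)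
  (* the exhaustion by finite-dimensional subspaces *)
  (X_ : nat -> set X)
  (X_finite_dim : forall n, finite_dim_subspace (X_ n))
  (X_nested : forall n, X_ n `<=` X_ n.+1)
  (X_dense : dense (\bigcup_n X_ n))
  (* base points of the Borel spaces of F and of its slices *)
  (p : F) (q : forall n, slice F (X_ n))
  (* the minimizers on the slices *)
  (rho_ : forall n, {measure set (borel (q n)) -> \bar R})
  (rho_regular : forall n, regular_measure (rho_ n))
  (rho_locally_finite : forall n, locally_finite (rho_ n))
  (rho_minimizer : forall n,
     minimizer_compact_variations (slice_lagrangian L (X_ n)) (rho_ n))
  (rho_ell_support : forall n x, measure_support (rho_ n) x ->
     ell (slice_lagrangian L (X_ n)) (rho_ n) x = 0%E)
  (rho_ell_inf : forall n,
     ereal_inf (range (ell (slice_lagrangian L (X_ n)) (rho_ n))) = 0%E)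
  (* the countable dense set and the compact neighborhoods *)
  (E : set F) (E_countable : countable E) (E_dense : dense E)
  (x_ : forall n, nat -> slice F (X_ n))
  (x_enum : forall n, set_val @` range (x_ n) = E `&` slice F (X_ n))
  (x_dense : forall n, dense (range (x_ n)))
  (V : forall n, nat -> nat -> set (slice F (X_ n)))
  (V_compact : forall n j k, compact (V n j k))
  (V_nbhs : forall n j k, nbhs (x_ n j) (V n j k))
  (V_ball : forall n j k y, V n j k y ->
     `|set_val (set_val y) - set_val (set_val (x_ n j))| < k.+1%:R^-1)
  (V_regclosed : forall n j k, V n j k = closure (V n j k)°)
  (* the subsequence *)
  (nk : nat -> nat) (nk_increasing : increasing_seq nk)
  (nk_cvg : forall D, finite_unions V D ->
     exists nu : {finite_measure set (borel p) -> \bar R},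
       weak_cvg_on D (fun k => extend_by_zero p (rho_ (nk k))) nu)
  (* the measure obtained in the limit *)
  (rho : {measure set (borel p) -> \bar R})
  (rho_def : forall A : set (borel p), measurable A ->
     rho A = outer_content
               (inner_content (finite_unions V)
                  (limit_content (fun k => extend_by_zero p (rho_ (nk k))))) A) :
  (forall U : set F, open U -> inner_regular rho U) /\ regular_measure rho.
Proof.
have hF : hausdorff_space F.
  by apply: hausdorff_subspace; exact: norm_hausdorff.
have hS n : hausdorff_space (slice F (X_ n)) by exact: hausdorff_subspace.
have rho_inner := limit_measure_open_inner_regular V_compact rho_def.
split=> //.
have local_bound (x : F) : exists2 U, open_nbhs x U & (rho U < +oo)%E.
  have [U [oU Ux] LU] := lagrangian_pos_nbhs L_continuous (L_diag_gt0 x).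
  exists U => //; have c0 : 0 < L x x / 2 by rewrite divr_gt0.
  (* [U] is chosen in [F] independently of [n], so the mass bound for its trace on each slice is
     uniform in [n]. *)
  have mass n : (extend_by_zero p (rho_ n) U <= ((L x x / 2)^-1)%:E)%E.
    have oV : open (set_val @^-1` U : set (slice F (X_ n))) by exists U.
    apply: (minimizer_mass_bound (hS n) _ _ (rho_ell_support n) _ oV c0).
    - by move=> y z; exact: L_ge0.
    - move=> y z; apply: (@continuous_comp _ _ _
        (fun z : slice F (X_ n) => (set_val y, set_val z) : F * F)
        (fun z => L z.1 z.2)); last exact: L_continuous.
      apply: (@cvg_pair _ _ _ (nbhs z) (nbhs (set_val y : F))
        (nbhs (set_val z : F))); first exact: cvg_cst.
      exact: initial_continuous.
    - by have [] := rho_regular n _ (open_borel oV).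
    - by move=> y z; exact: LU.
  apply: (@le_lt_trans _ _ ((L x x / 2)^-1)%:E); last exact: ltry.
  rewrite (limit_measure_open rho_def)//; apply: ge_ereal_sup => _ [D [DD DU] <-].
  have mD : measurable (D : set (borel p)).
    by apply: compact_borel => //; exact: finite_unions_compact DD.
  have [nu cvg_nu] := nk_cvg D DD.
  (* Weak convergence on [D] makes the [limn] in [limit_content] a genuine limit, so bounds on the
     terms pass to it. *)
  apply: lime_le.
    by apply/cvg_ex; exists (nu D); exact: weak_cvg_on_mass cvg_nu.
  apply: nearW => k; apply: le_trans (mass (nk k)).
  by rewrite le_measure ?inE//; exact: open_borel.
have [U_ [oU Uoo Ucov]] := separable_lindelof p
  (@countable_uniformity_subspace R X F) F_separable local_bound.
apply: regular_measure_open_cover oU Uoo Ucov => //.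
exact: limit_measure_outer_regular rho_def.
Qed.
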